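(* Let $k\ge 2$ be an integer. Then, as $n\to\infty$, $$p_k(0,2,n)\sim p_k(1,2,n)\sim \frac{p_k(n)}{2},$$ and, for all sufficiently large $n$, $$p_k(0,2,n)>p_k(1,2,n)\ \text{ if } n \text{ is even},\qquad p_k(0,2,n)<p_k(1,2,n)\ \text{ if } n \text{ is odd}.$$
   Context: A partition of a positive integer $n$ is a non-increasing sequence of positive integers (parts) summing to $n$. For an integer $k\ge1$, $p_k(n)$ denotes the number of partitions of $n$ all of whose parts are perfect $k$th powers $m^k$ ($m\in\mathbb N$), with $p_k(0)=1$. For integers $0\le a<m$, $p_k(a,m,n)$ denotes the number of partitions of $n$ into perfect $k$th powers whose number of parts is congruent to $a$ modulo $m$. *)

(* Defs.v *)
From HB Require Import structures.
From mathcomp Require Import all_boot all_order all_algebra.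
From mathcomp Require Import all_classical all_reals all_analysis.

Set Implicit Arguments.
Unset Strict Implicit.
Unset Printing Implicit Defensive.

Definition is_partition (n : nat) (s : seq nat) : bool :=
  [&& sorted geq s, all (ltn 0) s & sumn s == n].

(* For k > 0, x = m ^ k forces m <= x, so the bound on m loses nothing;
   see [is_powerP]. *)
Definition is_power (k x : nat) : bool :=
  [exists m : 'I_x.+1, x == m ^ k].

(* A partition of n has at most n parts, each at most n, so the partitions of n
   are exactly the values of the sequences in the finite type n.-bseq 'I_n.+1
   which satisfy [is_partition n]; see [is_partition_bseq]. *)
Definition parts (n : nat) (s : n.-bseq 'I_n.+1) : seq nat :=
  [seq val i | i <- s].

Definition power_partitions (k n : nat) : {set n.-bseq 'I_n.+1} :=
  [set s | is_partition n (parts s) && all (is_power k) (parts s)].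

Definition p (k n : nat) : nat := #|power_partitions k n|.

Definition p_mod (k a m n : nat) : nat :=
  #|[set s in power_partitions k n | size (parts s) == a %[mod m]]|.

Lemma is_powerP (k x : nat) :
  0 < k -> reflect (exists m, x = m ^ k) (is_power k x).
Proof.
move=> k0; apply: (iffP existsP) => [[m /eqP ->]|[m ->]]; first by exists m.
have mk : m < (m ^ k).+1.
  case: m => [|m] //; rewrite ltnS -{1}(expn1 m.+1); exact: leq_pexp2l.
by exists (Ordinal mk).
Qed.

Lemma parts_inj (n : nat) : injective (@parts n).
Proof. by move=> s t /(inj_map val_inj) /val_inj. Qed.

Lemma is_partition_bseq (n : nat) (s : seq nat) :
  is_partition n s -> exists t : n.-bseq 'I_n.+1, parts t = s.
Proof.
case/and3P => _ s0 /eqP sn.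
have sz : size s <= n.
  rewrite -sn; elim: s s0 {sn} => [//|x s IH] /= /andP[x0 s0].
  by rewrite -add1n leq_add // IH.
have lt_s : all (fun x => x < n.+1) s.
  apply/allP => x xs; rewrite ltnS -sn; elim: s xs {s0 sn sz} => [//|y s IH] /=.
  rewrite inE => /orP[/eqP ->|/IH]; first exact: leq_addr.
  by move=> /leq_trans; apply; exact: leq_addl.
have sz' : size [seq inord x : 'I_n.+1 | x <- s] <= n by rewrite size_map.
exists (Bseq sz'); rewrite /parts /= -map_comp.
rewrite -[RHS]map_id; apply/eq_in_map => x xs /=.
by rewrite inordK //; exact: (allP lt_s).
Qed.

Lemma p0 (k : nat) : p k 0 = 1.
Proof.
apply/eqP/cards1P; exists [bseq]; apply/setP => s.
by rewrite [s]bseq0 !inE eqxx.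
Qed.

(* Main.v *)
Require Import Defs.
From HB Require Import structures.
From mathcomp Require Import all_boot all_order all_algebra.
From mathcomp Require Import all_classical all_reals all_analysis.
From mathcomp Require Import fintype finset zify ring lra.
Import Order.TTheory GRing.Theory Num.Theory numFieldNormedType.Exports.

(* Encode a partition into k-th powers by the multiplicity function g, where
   g m is the number of parts equal to m ^ k, and put K = 2 ^ k. As
   m ^ k = m mod 2, the number of parts is congruent mod 2 to n plus the number
   of parts m ^ k with m even. Trading K copies of m ^ k for one copy of
   (2 m) ^ k changes the latter number by an odd amount; doing or undoing this
   trade at the least possible m is an involution that cancels all partitions
   except the "balanced" ones, with g m < K and g (2 m) even for all m. Hence
   (-1) ^ n * (p_k(0, 2, n) - p_k(1, 2, n)) is the number of balanced
   partitions of n.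
   - This number is positive for large n, because n is a sum of k-th powers of
     odd numbers, each used at most twice (and 2 < K): Prouhet-Tarry-Escott
     pairs yield arbitrarily long arithmetic progressions of sums of distinct
     odd k-th powers, all with the same difference C; sums of powers of
     m = 1 mod C fill in the residues mod C; and a greedy use of the second
     copies extends a long enough interval to a half-line.
   - It is o(p_k(n)), because a balanced partition of a large n has a large
     part, which can be broken into ones and twos in arbitrarily many ways. *)

Set Implicit Arguments.
Unset Strict Implicit.
Unset Printing Implicit Defensive.

(** * Large numbers as sums of odd k-th powers *)

(** The shifts in [A] and [B] are even, so an odd [x] gives odd bases; [C] does not depend on [x],
    so it can serve as the common difference of progressions. *)
Lemma prouhet_tarry_escott (d : nat) : exists A B C,
  [/\ 0 < C, uniq A, uniq B, all (predC odd) A & all (predC odd) B] /\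
  forall j x, j <= d ->
    \sum_(a <- A) (x + a) ^ j = \sum_(b <- B) (x + b) ^ j + (j == d) * C.
Proof.
elim: d => [|d [A [B [C [[C0 uA uB eA eB] S]]]]].
  exists [:: 0], [::], 1; split=> // j x; rewrite leqn0 => /eqP->.
  by rewrite big_seq1 big_nil addn0.
(* [h] is even, to preserve parity, and exceeds all elements, so that shifted and unshifted copies
   are disjoint. *)
pose h := 2 * (\sum_(a <- A ++ B) a).+1.
have lth a : a \in A ++ B -> a < h.
  by move=> aAB; rewrite /h (big_rem a) //=; lia.
have h0 : 0 < h by rewrite /h; lia.
have uni s t : all (mem (A ++ B)) t -> uniq s -> uniq t ->
    uniq ([seq h + a | a <- s] ++ t).
  move=> /allP tAB us ut; rewrite cat_uniq ut map_inj_uniq ?us ?andbT /=.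
    apply/hasPn => a /tAB /lth; apply: contraL => /mapP[b _ ->].
    by rewrite -leqNgt leq_addr.
  exact: addnI.
have ev s t : all (predC odd) s -> all (predC odd) t ->
    all (predC odd) ([seq h + a | a <- s] ++ t).
  move=> /allP es et; rewrite all_cat et andbT; apply/allP => _ /mapP[a /es /= ea ->].
  by rewrite oddD /h oddM.
(* The signed sum over the new pair at x is the difference of the signed sums
   over the old pair at x + h and at x, so one more degree is annihilated. *)
exists ([seq h + a | a <- A] ++ B), ([seq h + a | a <- B] ++ A), (d.+1 * h * C).
split.
  split; rewrite ?muln_gt0 ?h0 ?C0 //; try exact: ev.
    by apply: uni => //; apply/allP => a; rewrite inE mem_cat orbC => ->.
  by apply: uni => //; apply/allP => a; rewrite inE mem_cat => ->.
have exp s j x : \sum_(a <- [seq h + a | a <- s]) (x + a) ^ j =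
    \sum_(i < j.+1) 'C(j, i) * h ^ (j - i) * \sum_(a <- s) (x + a) ^ i.
  rewrite big_map; under [RHS]eq_bigr do rewrite big_distrr /=.
  rewrite exchange_big; apply: eq_bigr => a _ /=.
  rewrite addnCA expnDn; apply: eq_bigr => i _; lia.
move=> j x; rewrite !big_cat /= !exp leq_eqVlt => /orP[/eqP->|jd].
  (* In degree d + 1 the terms i < d agree, the terms i = d + 1 cancel against the unshifted copies,
     and i = d leaves [d.+1 * h * C]. *)
  rewrite eqxx mul1n !big_ord_recr /= !binn !subnn !mul1n subSnn binSn expn1.
  rewrite (S d) // eqxx.
  under eq_bigr => i _ do rewrite S 1?ltnW // (ltn_eqF (ltn_ord i)) mul0n addn0.
  by rewrite mul1n mulnDr !addnA; ring.
rewrite (ltn_eqF jd) mul0n addn0 !big_ord_recr /= !binn !subnn !mul1n.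
under eq_bigr => i _ do
  rewrite S ?(leq_trans (ltnW (ltn_ord i)) jd) // (ltn_eqF (leq_trans (ltn_ord i) jd)) mul0n addn0.
by ring.
Qed.

(** The bound [N] marks where fresh bases can be added without repetition. *)
Definition odd_sum (k N n : nat) := exists s : seq nat,
  [/\ uniq s, all odd s, all (gtn N) s & \sum_(m <- s) m ^ k = n].

Lemma odd_sum_translate (k N x n : nat) (A : seq nat) :
  odd x -> N <= x -> uniq A -> all (predC odd) A -> odd_sum k N n ->
  odd_sum k (x + (\sum_(a <- A) a).+1) (n + \sum_(a <- A) (x + a) ^ k).
Proof.
move=> ox Nx uA /allP eA [s [us os /allP bs <-]].
have lex a : a \in s -> a < x by move/bs => /= /leq_trans; apply.
exists (s ++ [seq x + a | a <- A]); split.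
- rewrite cat_uniq us map_inj_uniq ?uA; last exact: addnI.
  rewrite andbT; apply/hasPn => _ /mapP[a _ ->]; apply/negP => /lex; lia.
- rewrite all_cat os; apply/allP => _ /mapP[a /eA /= ea ->].
  by rewrite oddD ox (negPf ea).
- rewrite all_cat; apply/andP; split.
    by apply/allP => a /lex /=; lia.
  by apply/allP => _ /mapP[a aA ->] /=; rewrite (big_rem a) //=; lia.
- by rewrite big_cat big_map.
Qed.

Lemma odd_sum_weaken k N M n : N <= M -> odd_sum k N n -> odd_sum k M n.
Proof.
move=> NM [s [us os bs ss]]; exists s; split=> //.
by apply/allP => m /(allP bs) /= mN; apply: leq_trans NM.
Qed.

(** Adding m ^ k with m = 2 C N + 1 raises the residue by one; this m is odd, is 1 mod C, and is at
    least N, hence fresh. *)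
Lemma odd_sum_residue (k C r : nat) : 0 < C ->
  exists N T, odd_sum k N T /\ T = r %[mod C].
Proof.
move=> C0; elim: r => [|r [N [T [sT Tr]]]].
  by exists 0, 0; split=> //; exists [::]; rewrite big_nil.
exists ((2 * C * N).+1 + 1), (T + (2 * C * N).+1 ^ k); split; last first.
  have x1 : (2 * C * N).+1 = 1 %[mod C].
    by rewrite -addn1 mulnAC modnMDl.
  by rewrite -modnDm Tr -(modnXm k C) x1 modnXm exp1n modnDm addn1.
have := @odd_sum_translate k N (2 * C * N).+1 T [:: 0] _ _ isT isT sT.
rewrite !big_seq1 addn0; apply; first by rewrite /= -mulnA oddM.
by nia.
Qed.

(** Each residue mod [C] has a representative [T r]. Every fresh [x] offers a choice between the
    blocks [x + B] and [x + A], the latter larger by [C], so progressions of step [C] grow from all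
    [T r] at once. *)
Lemma odd_sum_interval (k L : nat) : exists N a,
  forall r, r <= L -> odd_sum k N (a + r).
Proof.
have [A [B [C [[C0 uA uB eA eB] S]]]] := prouhet_tarry_escott k.
have [N [T [sT Tm]]] : exists N (T : nat -> nat),
    (forall r, r < C -> odd_sum k N (T r)) /\
    forall r, r < C -> T r = r %[mod C].
  move: {1 2}C => D; elim: D => [|c [N [T [sT Tm]]]]; first by exists 0, id.
  have [M [t [st tm]]] := odd_sum_residue k c C0.
  exists (maxn N M), (fun r => if r == c then t else T r).
  split=> r; rewrite ltnS leq_eqVlt; case: eqP => [->|_] //= rc; last exact: Tm.
    by apply: odd_sum_weaken st; exact: leq_maxr.
  by apply: odd_sum_weaken (sT _ rc); exact: leq_maxl.
have {}S x : \sum_(a <- A) (x + a) ^ k = \sum_(b <- B) (x + b) ^ k + C.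
  by rewrite S // eqxx mul1n.
have {N sT} s J : exists N b,
    forall r t, r < C -> t <= J -> odd_sum k N (b + T r + t * C).
  elim: J => [|j [M [b sM]]].
    exists N, 0 => r t rC; rewrite leqn0 => /eqP ->.
    by rewrite mul0n addn0; exact: sT.
  pose x := (2 * M).+1.
  have ox : odd x by rewrite /x /= oddM.
  have Mx : M <= x by rewrite /x; lia.
  exists (x + (\sum_(a <- A ++ B) a).+1), (b + \sum_(c <- B) (x + c) ^ k).
  move=> r t rC; rewrite leq_eqVlt => /orP[/eqP->|tj].
    have := odd_sum_translate ox Mx uA eA (sM r j rC (leqnn j)).
    rewrite S big_cat /= => /(@odd_sum_weaken _ _ (x + _)) sw.
    rewrite (_ : b + _ + _ + _ = b + T r + j * C + (\sum_(b0 <- B) (x + b0) ^ k + C)); last first.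
      by rewrite mulSn; ring.
    by apply: sw; rewrite leq_add2l ltnS leq_addr.
  have := odd_sum_translate ox Mx uB eB (sM r t rC tj).
  rewrite big_cat /= => /(@odd_sum_weaken _ _ (x + _)) sw.
  rewrite (_ : b + _ + _ + _ = b + T r + t * C + \sum_(b0 <- B) (x + b0) ^ k); last by ring.
  by apply: sw; rewrite leq_add2l ltnS leq_addl.
(* [U] bounds all [T r], so [U + r] is the representative of its class plus [t * C] with
   [t <= U + L]. *)
pose U := \sum_(r < C) T r.
have TU r : r < C -> T r <= U.
  by move=> rC; rewrite /U (bigD1 (Ordinal rC)) //= leq_addr.
have [N' [b sJ]] := s (U + L).
exists N', (b + U) => r rL.
have rC : (U + r) %% C < C by rewrite ltn_mod.
have /eqP := Tm _ rC; rewrite modn_mod eq_sym eqn_mod_dvd => [/dvdnP[t tE]|]; last first.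
  by rewrite (leq_trans (TU _ rC)) ?leq_addr.
have := TU _ rC => TUr.
have := sJ _ t rC; rewrite -addnA -tE -addnA subnKC; last by lia.
by apply; nia.
Qed.

Lemma leq_pow2r (k m n : nat) : m <= n -> m ^ k <= n ^ k.
Proof. by case: k => [|k] mn //; rewrite leq_exp2r. Qed.

(** For large i the upper half of the sum has at least 2 ^ k terms, each at least (i + 1) ^ k, and 2
    ^ k * (i + 1) ^ k = (2 i + 2) ^ k; [L] takes care of small i. *)
Lemma odd_power_sum_ge (k : nat) : exists L, forall i,
  i.*2.+1 ^ k <= L + \sum_(j < i) j.*2.+1 ^ k.
Proof.
exists ((2 ^ k).*2.*2.+1 ^ k) => i; case: (leqP i (2 ^ k).*2) => [ik|ki].
  by apply: leq_trans (leq_addr _ _); apply: leq_pow2r; lia.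
apply: leq_trans (leq_addl _ _).
rewrite -(big_mkord xpredT (fun j => j.*2.+1 ^ k)) (@big_cat_nat _ _ _ (uphalf i)) //=;
  last by lia.
apply: leq_trans (leq_addl _ _).
apply: (@leq_trans (\sum_(uphalf i <= j < i) i.+1 ^ k)).
  rewrite sum_nat_const_nat; apply: (@leq_trans (2 ^ k * i.+1 ^ k)).
    by rewrite -expnMn leq_pow2r //; lia.
  by rewrite leq_mul2r; apply/orP; right; lia.
rewrite !big_nat; apply: leq_sum => j /andP[ij _].
by rewrite leq_pow2r //; lia.
Qed.

(** Sums over [s] cover an interval of length [L], and [t] extends it greedily: as (2 i + 1) ^ k <=
    L + S i, the translate by (2 i + 1) ^ k leaves no gap after the interval already reached. *)
Lemma eventually_sum_two_odd (k : nat) : 0 < k -> exists n0, forall n, n0 <= n ->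
  exists s t : seq nat, [/\ uniq s, uniq t, all odd s, all odd t
    & \sum_(m <- s ++ t) m ^ k = n].
Proof.
move=> k0; have [L Lge] := odd_power_sum_ge k.
have [N [a aL]] := odd_sum_interval k L.
pose S i := \sum_(j < i) j.*2.+1 ^ k.
have greedy i n : a <= n <= a + L + S i -> exists s t : seq nat,
    [/\ uniq s, uniq t, all odd s, all odd t & all (gtn i.*2) t] /\
    \sum_(m <- s ++ t) m ^ k = n.
  elim: i n => [|i IH] n; rewrite /S.
    rewrite big_ord0 addn0 => /andP[an nL].
    have [|s [us os _ ss]] := aL (n - a); first by lia.
    by exists s, [::]; split=> //; rewrite cats0 ss subnKC.
  rewrite big_ord_recr /= -/(S i) => /andP[an nL].
  case: (leqP n (a + L + S i)) => [le|gt].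
    have [|s [t [[us ut os ot bt] st]]] := IH n; first by rewrite an.
    exists s, t; split=> //; split=> //.
    by apply/allP => m /(allP bt) /=; lia.
  have := Lge i; rewrite -/(S i) => Li.
  have [|s [t [[us ut os ot bt] st]]] := IH (n - i.*2.+1 ^ k).
    by apply/andP; lia.
  exists s, (i.*2.+1 :: t); split; first split=> //=.
  - rewrite ut andbT; apply/negP => /(allP bt) /=; lia.
  - by rewrite odd_double.
  - by rewrite doubleS ltnSn /=; apply/allP => m /(allP bt) /=; lia.
  - rewrite big_cat big_cons /= addnCA -big_cat st subnKC //; lia.
have Si i : i <= S i.
  rewrite -[X in X <= _]card_ord -sum1_card; apply: leq_sum => j _.
  by rewrite expn_gt0.
exists a => n an; have [|s [t [[us ut os ot _] st]]] := greedy n n.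
  by rewrite an; have := Si n; lia.
by exists s, t; split.
Qed.

(** * Partitions as multiplicity functions *)

(* [f m] is the multiplicity of the part [m ^ k], for m <= n. *)
Definition mult (n : nat) := {ffun 'I_n.+1 -> 'I_n.+1}.

(** Extension by zero, so that indices such as [m.*2] need no bound. *)
Definition coef n (f : mult n) (m : nat) : nat := oapp (val \o f) 0 (insub m).

Definition mk_mult n (g : nat -> nat) : mult n := [ffun i => inord (g (val i))].

(** The weight m ^ k gives the partitioned number, the weight 1 the number of parts, and the
    indicator of even m the number of parts with even base. *)
Definition wsum (n : nat) (w g : nat -> nat) := \sum_(m < n.+1) g m * w m.

(** For k > 0 the base 0 adds nothing to the sum, so its multiplicity is fixed to be 0. *)
Definition mults (k n : nat) : {set mult n} :=
  [set f | (coef f 0 == 0) && (wsum n (expn^~ k) (coef f) == n)].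

Lemma coef_ord n (f : mult n) (i : 'I_n.+1) : coef f i = f i.
Proof. by rewrite /coef valK. Qed.

Lemma coef_default n (f : mult n) m : n < m -> coef f m = 0.
Proof. by move=> nm; rewrite /coef insubF // ltnS leqNgt nm. Qed.

Lemma mk_multK n (f : mult n) g : coef f =1 g -> mk_mult n g = f.
Proof.
by move=> fg; apply/ffunP => i; rewrite ffunE -fg coef_ord inord_val.
Qed.

Lemma coef_mk n g : (forall m, g m <= n) -> (forall m, n < m -> g m = 0) ->
  coef (mk_mult n g) =1 g.
Proof.
move=> gn g0 m; case: (leqP m n) => [mn|nm]; last by rewrite coef_default // g0.
by rewrite (coef_ord _ (Ordinal (mn : m < n.+1))) ffunE /= inordK // ltnS.
Qed.

Lemma eq_wsum n w g g' : g =1 g' -> wsum n w g = wsum n w g'.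
Proof. by move=> gg'; apply: eq_bigr => i _; rewrite gg'. Qed.

Lemma wsum_ge n w g m : (forall m, n < m -> g m = 0) -> g m * w m <= wsum n w g.
Proof.
move=> g0; case: (leqP m n) => [mn|/g0->]; last by rewrite mul0n.
by rewrite /wsum (bigD1 (Ordinal (mn : m < n.+1))) //= leq_addr.
Qed.

Lemma wsum_update n w g g' (s : seq nat) : uniq s -> all (geq n) s ->
  (forall x, x \notin s -> g' x = g x) ->
  wsum n w g' + \sum_(x <- s) g x * w x = wsum n w g + \sum_(x <- s) g' x * w x.
Proof.
move=> us /allP sn gg'.
have split h : wsum n w h = \sum_(x <- s) h x * w x +
    \sum_(0 <= i < n.+1 | i \notin s) h i * w i.
  rewrite /wsum -(big_mkord xpredT (fun i => h i * w i)) (bigID (mem s)) /=; congr addn.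
  rewrite -big_filter; apply: perm_big; apply: uniq_perm => //.
    by rewrite filter_uniq // iota_uniq.
  move=> x; rewrite mem_filter mem_index_iota /=.
  by case: (boolP (x \in s)) => // /sn /=; rewrite ltnS.
rewrite !split.
have -> : \sum_(0 <= i < n.+1 | i \notin s) g' i * w i =
    \sum_(0 <= i < n.+1 | i \notin s) g i * w i.
  by apply: eq_bigr => x /gg' ->.
by rewrite addnAC [in RHS]addnAC; congr (_ + _); rewrite addnC.
Qed.

Section Mults.
Variables (k n : nat) (k0 : 0 < k).

Lemma multsP f : reflect (coef f 0 = 0 /\ wsum n (expn^~ k) (coef f) = n)
  (f \in mults k n).
Proof. by rewrite inE; apply: (iffP andP) => [][/eqP ? /eqP ?]. Qed.

(** The bound [g m <= n] required by the finite type follows from the sum, as m ^ k >= 1 for m >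
    0. *)
Lemma mults_coef_mk g : g 0 = 0 -> (forall m, n < m -> g m = 0) ->
  wsum n (expn^~ k) g = n -> mk_mult n g \in mults k n /\ coef (mk_mult n g) =1 g.
Proof.
move=> g0 gn gw; have gE : coef (mk_mult n g) =1 g.
  apply: coef_mk => // -[|m]; first by rewrite g0.
  rewrite -[leqRHS]gw; apply: leq_trans (wsum_ge _ _ gn).
  by rewrite -[leqLHS]muln1 leq_mul // expn_gt0.
by split=> //; apply/multsP; rewrite gE g0 (eq_wsum _ _ gE).
Qed.

(** Injections into [B] can thus be written as plain functions on nat. *)
Lemma leq_card_mults (T : finType) (A : {set T}) (B : {set mult n})
    (phi : T -> nat -> nat) :
  {in A, forall a, phi a 0 = 0} -> 
  {in A, forall a m, n < m -> phi a m = 0} ->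
  {in A, forall a, wsum n (expn^~ k) (phi a) = n} ->
  {in A, forall a b, b \in mults k n -> coef b =1 phi a -> b \in B} ->
  {in A &, forall a a', phi a =1 phi a' -> a = a'} -> #|A| <= #|B|.
Proof.
move=> phi0 phin phiw AB inj.
pose F a := mk_mult n (phi a).
have FE a : a \in A -> F a \in mults k n /\ coef (F a) =1 phi a.
  by move=> aA; apply: mults_coef_mk; [exact: phi0 | exact: phin | exact: phiw].
rewrite -(@card_in_imset _ _ F) => [|a a' aA a'A FF].
  apply: subset_leq_card; apply/subsetP => _ /imsetP[a aA ->].
  by have [? ?] := FE a aA; apply: AB aA _ _ _.
apply: inj => // m.
by rewrite -(proj2 (FE a aA)) -(proj2 (FE a' a'A)) FF.
Qed.

(** * Cancellation of the unbalanced partitions by trading *)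

Let K := 2 ^ k.

Definition balanced (g : nat -> nat) (m : nat) := (g m < K) && ~~ odd (g m.*2).

Definition balanced_mults : {set mult n} :=
  [set f in mults k n | all (balanced (coef f)) (iota 0 n.+1)].

(** The parity of [g m.*2] decides the direction: if odd, one (2 m) ^ k is split; if even, K copies
    of m ^ k are merged, and these exist when [g] is unbalanced at [m]. *)
Definition trade (g : nat -> nat) (m x : nat) : nat :=
  if x == m then (if odd (g m.*2) then g m + K else g m - K)
  else if x == m.*2 then (if odd (g m.*2) then (g x).-1 else (g x).+1)
  else g x.

Definition first_unbalanced g := find (predC (balanced g)) (iota 0 n.+1).

Definition even_size (g : nat -> nat) := wsum n (fun m => ~~ odd m) g.

Lemma tradeP f (g := coef f) (m := first_unbalanced g) :
  f \in mults k n :\: balanced_mults ->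
  [/\ 0 < m, m.*2 <= n, ~~ balanced g m & forall x, x < m -> balanced g x].
Proof.
rewrite !inE => /andP[+ fm]; rewrite fm /= => nb.
have /multsP[f0 fw] : f \in mults k n by rewrite inE.
have hasn : has (predC (balanced g)) (iota 0 n.+1) by rewrite has_predC.
have mn : m < n.+1 by rewrite -[n.+1](size_iota 0) -has_find.
have bm : ~~ balanced g m.
  by have := nth_find 0 hasn; rewrite nth_iota // add0n.
have fn x : n < x -> g x = 0 by move=> nx; rewrite /g coef_default.
have m0 : 0 < m.
  case: (posnP m) bm => // ->; rewrite /balanced double0 /g f0 /K /= expn_gt0 //.
split=> // [|x xm]; last first.
  have := @before_find _ 0 (predC (balanced g)) (iota 0 n.+1) x xm.
  by rewrite nth_iota ?add0n /= => [/negbFE //|]; exact: ltn_trans mn.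
(* If 2 m > n, then g (2 m) = 0, so g m >= K and n >= K * m ^ k = (2 m) ^ k >= 2 m. *)
rewrite leqNgt; apply/negP => n2m; move: bm.
rewrite /balanced (fn _ n2m) andbT -leqNgt => Kg.
suff: m.*2 <= n by lia.
rewrite -fw; apply: leq_trans (wsum_ge (expn^~ k) m fn).
apply: (@leq_trans (K * m ^ k)); last by rewrite leq_mul2r Kg orbT.
rewrite /K -expnMn mul2n.
by case: (k) k0 => // k' _; rewrite expnS leq_pmulr // expn_gt0 double_gt0 m0.
Qed.

Lemma odd_K : odd K = false.
Proof. by rewrite /K oddX -leqn0 leqNgt k0. Qed.

(** Below [m] only the parity of [g m] matters, when [x.*2 = m], and it is kept because K is
    even. *)
Lemma balanced_trade g m x : 0 < m -> ~~ balanced g m -> x < m ->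
  balanced (trade g m) x = balanced g x.
Proof.
move=> m0 nb xm; rewrite /balanced /trade (ltn_eqF xm).
have -> : (x == m.*2) = false by lia.
have -> : (x.*2 == m.*2) = false by lia.
case: eqP => [->|//]; case: ifP => ogm; rewrite ?oddD ?odd_K ?addbF //.
move: nb; rewrite /balanced ogm andbT -leqNgt => Kg.
by rewrite oddB // odd_K addbF.
Qed.

Lemma odd_trade g m : 0 < m -> odd (trade g m m.*2) = ~~ odd (g m.*2).
Proof.
move=> m0; rewrite /trade; have -> : (m.*2 == m) = false by lia.
by rewrite eqxx; case: ifP => //; case: (g _) => //= c; case: (odd c).
Qed.

Lemma trade_unbalanced g m : 0 < m -> ~~ balanced g m -> ~~ balanced (trade g m) m.
Proof.
move=> m0 nb; rewrite /balanced negb_and odd_trade // negbK -leqNgt /trade eqxx.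
by case: ifP => _; rewrite ?leq_addl ?orbT.
Qed.

Lemma wsum_trade w g m : 0 < m -> m.*2 <= n -> ~~ balanced g m ->
  if odd (g m.*2) then wsum n w (trade g m) + w m.*2 = wsum n w g + K * w m
  else wsum n w (trade g m) + K * w m = wsum n w g + w m.*2.
Proof.
move=> m0 mn nb; have := @wsum_update n w g (trade g m) [:: m; m.*2].
rewrite /= inE !big_cons !big_nil andbT.
have -> : (m == m.*2) = false by lia.
have -> : m <= n by lia.
rewrite mn => /(_ isT isT) H.
have {}H := H _; move: H; rewrite /trade !eqxx.
have -> : (m.*2 == m) = false by lia.
move=> /(_ _)/wrap[].
  by move=> x; rewrite !inE => /norP[/negPf-> /negPf->].
move: nb; rewrite /balanced; case: ifP => og.
  by case: (g m.*2) og => //= c _ _; rewrite mulSn mulnDl; lia.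
rewrite andbT -leqNgt => Kg; rewrite mulnBl mulSn.
by have := leq_mul Kg (leqnn (w m)); lia.
Qed.

Lemma first_unbalanced_trade f (g := coef f) (m := first_unbalanced g) :
  f \in mults k n :\: balanced_mults -> first_unbalanced (trade g m) = m.
Proof.
move=> /tradeP; rewrite -/g -/m => -[m0 mn nb bal].
rewrite /first_unbalanced; set s := iota _ _.
have ms : m < size s by rewrite size_iota; lia.
rewrite -[s](cat_take_drop m) find_cat.
have -> : has (predC (balanced (trade g m))) (take m s) = false.
  apply/negbTE; rewrite -all_predC; apply/allP => x.
  rewrite take_iota mem_iota /= add0n negbK => xm.
  by rewrite balanced_trade // ?bal //; lia.
rewrite (drop_nth 0) // nth_iota; last by lia.
rewrite add0n /= trade_unbalanced // size_take ms addn0 //.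
Qed.

(** The traded function has the same least unbalanced index m, and its parity at 2 m tells the
    direction of the trade. *)
Lemma trade_inj f f' : f \in mults k n :\: balanced_mults ->
  f' \in mults k n :\: balanced_mults ->
  trade (coef f) (first_unbalanced (coef f)) =1
  trade (coef f') (first_unbalanced (coef f')) -> f = f'.
Proof.
move=> fX f'X E; have [m0 mn nb _] := tradeP fX; have [_ _ nb' _] := tradeP f'X.
have mm : first_unbalanced (coef f) = first_unbalanced (coef f').
  rewrite -(first_unbalanced_trade fX) -(first_unbalanced_trade f'X).
  apply: eq_find => x /=; rewrite /balanced !E //.
move: E nb'; rewrite -mm; move: (first_unbalanced _) m0 mn nb => m m0 mn nb E nb'.
have oE : odd (coef f m.*2) = odd (coef f' m.*2).
  by apply: negb_inj; rewrite -!odd_trade // E.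
rewrite -(mk_multK (fun x => erefl (coef f x))) -(mk_multK (fun x => erefl (coef f' x))).
apply/ffunP => i; rewrite !ffunE; congr inord; move: (val i) => x.
have := E x; have := E m; rewrite /trade eqxx -oE; move: nb nb'; rewrite /balanced -oE.
case: eqP => [->|_].
  by case: ifP => _; rewrite ?andbF ?andbT -?leqNgt => *; lia.
case: eqP => [->|_] //; case: ifP => o *; last by lia.
by have := odd_gt0 o; move: (o); rewrite oE => /odd_gt0; lia.
Qed.

Lemma mults_trade f (g := coef f) (m := first_unbalanced g) :
  f \in mults k n :\: balanced_mults ->
  [/\ trade g m 0 = 0, forall x, n < x -> trade g m x = 0,
      wsum n (expn^~ k) (trade g m) = n &
      odd (even_size (trade g m)) = ~~ odd (even_size g)].
Proof.
move=> fX; have [m0 mn nb _] := tradeP fX; rewrite -/g -/m in m0 mn nb *.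
have /multsP[f0 fw] : f \in mults k n by case/setDP: fX.
split.
- rewrite /trade; have -> : (0 == m) = false by lia.
  by have -> : (0 == m.*2) = false by lia.
- move=> x nx; rewrite /trade; have -> : (x == m) = false by lia.
  have -> : (x == m.*2) = false by lia.
  exact: coef_default.
- have := wsum_trade (expn^~ k) m0 mn nb; rewrite fw -mul2n expnMn -/K.
  by case: ifP; lia.
(* The base 2 m is even and contributes one; the K parts of base m contribute 0 or K, which is
   even. *)
- have := wsum_trade (fun x => ~~ odd x) m0 mn nb; rewrite odd_double /=.
  rewrite -/(even_size _) -/(even_size _).
  by case: ifP => _ /(congr1 odd); 
    rewrite !oddD oddM odd_K /=; do 2 case: (odd _).
Qed.

Definition parity_mults (b : bool) : {set mult n} :=
  [set f in mults k n | odd (even_size (coef f)) == b].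

Lemma card_trade b :
  #|parity_mults b :\: balanced_mults| <= #|parity_mults (~~ b) :\: balanced_mults|.
Proof.
have sub f : f \in parity_mults b :\: balanced_mults ->
    f \in mults k n :\: balanced_mults /\ odd (even_size (coef f)) = b.
  by rewrite !inE => /andP[-> /andP[-> /eqP]].
apply: (@leq_card_mults _ _ _ (fun f => trade (coef f) (first_unbalanced (coef f)))).
- by move=> f /sub[/mults_trade[]].
- by move=> f /sub[/mults_trade[]].
- by move=> f /sub[/mults_trade[]].
- move=> f /sub[fX fb] f' f'X E.
  have [_ _ _ par] := mults_trade fX; have [m0 mn nb _] := tradeP fX.
  rewrite in_setD [in X in _ && X]inE f'X /= /even_size (eq_wsum _ _ E) par fb eqxx andbT.
  rewrite inE f'X andTb; apply/allPn; exists (first_unbalanced (coef f)).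
    by rewrite mem_iota; lia.
  by rewrite /balanced !E -/(balanced _ _) trade_unbalanced.
- by move=> f f' /sub[fX _] /sub[f'X _]; exact: trade_inj.
Qed.

Lemma card_mults_parity :
  #|mults k n| = #|parity_mults false| + #|parity_mults true|.
Proof.
rewrite -(cardsID (parity_mults false)); congr (_ + _); apply: eq_card => f;
  by rewrite !inE; case: (coef f 0 == 0); case: (wsum _ _ _ == n); case: (odd _).
Qed.

(** [card_trade] in both directions equates the unbalanced parts of the two classes. Balanced
    functions all lie in the even class, since their multiplicities at even bases are even. *)
Lemma card_parity_mults :
  #|parity_mults false| = #|parity_mults true| + #|balanced_mults|.
Proof.
have bal f : f \in balanced_mults -> odd (even_size (coef f)) = false.
  rewrite inE => /andP[_ /allP bf]; apply/negbTE.
  rewrite /even_size /wsum; elim/big_ind: _ => // [x y ? ?|i _].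
    by rewrite oddD negb_add; apply/eqP; apply/idP/idP; lia.
  rewrite oddM; case: (boolP (odd i)) => oi; first by rewrite andbF.
  rewrite andbT -[val i]odd_double_half (negPf oi) add0n.
  have /bf/andP[] // : i./2 \in iota 0 n.+1 by rewrite mem_iota; have := ltn_ord i; lia.
have -> : parity_mults true = parity_mults true :\: balanced_mults.
  apply/setP => f; rewrite in_setD; case: (boolP (f \in balanced_mults)) => // /bal fe.
  by rewrite inE fe andbF.
have -> : #|balanced_mults| = #|parity_mults false :&: balanced_mults|.
  congr #|pred_of_set _|; apply/setP => f; rewrite in_setI andbC.
  case: (boolP (f \in balanced_mults)) => //= fb.
  by rewrite inE bal // eqxx andbT; move: fb; rewrite inE => /andP[].
rewrite -[LHS](cardsID balanced_mults) addnC; congr (_ + _).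
by apply/eqP; rewrite eqn_leq !card_trade.
Qed.

(** Modulo 2, a part m ^ k equals 1 plus the indicator of even m. *)
Lemma even_size_parity f : f \in mults k n ->
  odd (wsum n (fun=> 1) (coef f)) = odd n (+) odd (even_size (coef f)).
Proof.
move=> /multsP[_ /(congr1 odd) <-]; rewrite -oddD /even_size /wsum -big_split /=.
elim/big_ind2: _ => // [x1 x2 y1 y2|i _]; first by rewrite !oddD => -> ->.
rewrite -mulnDr !oddM oddD oddX /=.
by case: (k) k0 => // k' _ /=; case: (odd i).
Qed.

End Mults.

(** * Balanced partitions: existence and scarcity *)

Lemma wsum_count n w (s : seq nat) : all (geq n) s ->
  wsum n w (fun m => count_mem m s) = \sum_(x <- s) w x.
Proof.
rewrite /wsum; elim: s => [|x s IH] /= => [_|/andP[xn sn]].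
  by rewrite big_nil big1.
under eq_bigr do rewrite mulnDl.
rewrite big_split /= IH // big_cons; congr (_ + _).
rewrite (bigD1 (Ordinal (xn : x < n.+1))) //= eqxx mul1n big1 ?addn0 // => i.
by rewrite -val_eqE /= eq_sym => /negPf ->.
Qed.

Lemma balanced_mults_gt0 (k : nat) : 1 < k ->
  exists n0, forall n, n0 <= n -> 0 < #|balanced_mults k n|.
Proof.
move=> k1; have k0 := ltnW k1.
have [n0 rep] := eventually_sum_two_odd k0; exists n0 => n /rep.
move=> [s [t [us ut os ot st]]].
pose g m := count_mem m (s ++ t).
have godd m : ~~ odd m -> g m = 0.
  move=> em; apply/count_memPn; apply: contra em.
  by rewrite mem_cat => /orP[/(allP os)|/(allP ot)].
have stn : all (geq n) (s ++ t).
  apply/allP => m mst /=; rewrite -st (big_rem m) //=.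
  apply: leq_trans (leq_addr _ _); case: (m) => // m'.
  by rewrite -{1}[m'.+1]expn1 leq_pexp2l.
have [|m nm||gX gE] := @mults_coef_mk k n g.
- exact: godd.
- apply/count_memPn; apply: contraL nm => /(allP stn) /=; lia.
- by rewrite wsum_count.
apply/card_gt0P; exists (mk_mult n g); rewrite inE gX andTb.
apply/allP => m _; rewrite /balanced !gE (godd m.*2) ?odd_double // andbT.
(* Each base occurs at most twice, and k >= 2 gives 2 < 4 <= 2 ^ k. *)
apply: (@leq_trans 3); last by rewrite (leq_trans _ (leq_pexp2l _ k1)).
by rewrite /g count_cat !count_uniq_mem // ltnS; do 2 case: (_ \in _).
Qed.

(** With all bases below [Q] and multiplicities below 2 ^ k, the sum is at most 2 ^ k * Q ^ k *
    Q. *)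
Lemma balanced_mults_large_part (k Q : nat) : 0 < k -> exists n0, forall n f,
  n0 <= n -> f \in balanced_mults k n -> exists m, [/\ Q <= m, m <= n & 0 < coef f m].
Proof.
move=> k0; exists (2 ^ k * Q ^ k * Q).+1 => n f nbig.
rewrite inE => /andP[/multsP[_ fw] /allP bal].
case: (boolP (has (fun m => (Q <= m) && (0 < coef f m)) (iota 0 n.+1))) => [/hasP[m]|/hasPn nom].
  by rewrite mem_iota add0n => /andP[_ mn] /andP[Qm fm]; exists m.
suff : wsum n (expn^~ k) (coef f) <= 2 ^ k * Q ^ k * Q by rewrite fw; lia.
have small m : m <= n -> Q <= m -> coef f m = 0.
  move=> mn Qm; apply/eqP; rewrite -leqn0 leqNgt.
  by have := nom m; rewrite mem_iota add0n ltnS mn Qm => ->.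
have bound (i : 'I_n.+1) : coef f i * i ^ k <= (i < Q) * (2 ^ k * Q ^ k).
  case: (ltnP i Q) => iQ; last by rewrite small // -ltnS.
  rewrite mul1n leq_mul ?leq_pow2r //; last exact: ltnW.
  by have /bal/andP[/ltnW] : val i \in iota 0 n.+1 by rewrite mem_iota /=.
apply: (@leq_trans (\sum_(i < n.+1) (i < Q) * (2 ^ k * Q ^ k))).
  by apply: leq_sum => i _; exact: bound.
rewrite -big_distrl /= mulnC leq_mul2l; apply/orP; right.
rewrite -(big_mkord xpredT (fun i => nat_of_bool (i < Q))) -big_mkcond sum1_count.
rewrite -size_filter; apply: (@leq_trans (size (iota 0 Q))); last by rewrite size_iota.
apply: uniq_leq_size; first by rewrite filter_uniq ?iota_uniq.
by move=> i; rewrite mem_filter mem_iota => /andP[].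
Qed.

Lemma leq_mul_card_balanced (k M : nat) : 0 < k -> exists n0, forall n,
  n0 <= n -> M * #|balanced_mults k n| <= #|mults k n|.
Proof.
(* The product bounds the total size of the twos created below; the 3 keeps the large base apart
   from 1 and 2. *)
move=> k0; pose K := 2 ^ k; pose Q := K * (K * (K * M)) + 3.
have [n0 large] := balanced_mults_large_part Q k0; exists n0 => n /large {}large.
pose big (f : mult n) m := (Q <= m) && (0 < coef f m).
pose top (f : mult n) := nth 0 (iota 0 n.+1) (find (big f) (iota 0 n.+1)).
have topP f : f \in balanced_mults k n -> [/\ Q <= top f, top f <= n & 0 < coef f (top f)].
  move=> /large[m [Qm mn fm]].
  have hb : has (big f) (iota 0 n.+1).
    by apply/hasP; exists m; rewrite ?mem_iota ?add0n ?ltnS ?mn // /big Qm.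
  have /andP[Qt ft] := nth_find 0 hb; split=> //.
  have := mem_nth 0 (_ : find (big f) (iota 0 n.+1) < size (iota 0 n.+1)).
  by rewrite -has_find mem_iota add0n ltnS => /(_ hb).
(* Break one copy of the large part [top f] into [t] twos and the rest ones. The
   new number of twos, [coef f 2 + K * (coef f 1 + K * j)], has j and the old
   numbers of twos and ones as base-K digits; the new number of ones then gives
   back [top f]. *)
pose t (a : mult n * 'I_M) := K * (K * a.2 + coef a.1 1).
pose phi (a : mult n * 'I_M) (x : nat) : nat :=
  if x == 1 then coef a.1 1 + top a.1 ^ k - K * t a
  else if x == 2 then coef a.1 2 + t a
  else if x == top a.1 then (coef a.1 x).-1 else coef a.1 x.
have K1 : 0 < K by rewrite expn_gt0.
have small f m : f \in balanced_mults k n -> m <= n -> coef f m < K.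
  rewrite inE => /andP[_ /allP bal] mn.
  by have /bal/andP[] : m \in iota 0 n.+1 by rewrite mem_iota.
(* Hence the truncated subtraction in [phi] is exact. *)
have tle f j : f \in balanced_mults k n -> K * t (f, j) <= top f ^ k.
  move=> fb; have [Qt tn ft] := topP f fb.
  apply: (@leq_trans Q); last first.
    apply: leq_trans Qt _; case: (top f) => // m.
    by rewrite -{1}[m.+1]expn1 leq_pexp2l.
  apply: leq_trans (leq_addr _ _); rewrite /t /= !leq_mul2l.
  do 2 (apply/orP; right).
  have := small f 1 fb; have := ltn_ord j; nia.
rewrite -[M in leqLHS]card_ord -cardsT mulnC -cardsX.
have inX a : a \in setX (balanced_mults k n) [set: 'I_M] -> a.1 \in balanced_mults k n.
  by case: a => f j; rewrite in_setX => /andP[].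
apply: (@leq_card_mults k n _ _ _ phi).
- move=> [f j] /inX /= fb; have [Qt _ _] := topP f fb; rewrite /phi /=.
  have -> : (0 == top f) = false by rewrite /Q in Qt; lia.
  by move: fb; rewrite inE => /andP[/multsP[]].
- move=> [f j] /inX /= fb m nm; have [Qt tn _] := topP f fb; rewrite /phi /=.
  have Q3 : 3 <= Q by rewrite leq_addl.
  have -> : (m == 1) = false by lia.
  have -> : (m == 2) = false by lia.
  have -> : (m == top f) = false by lia.
  exact: coef_default.
- move=> [f j] /inX /= fb; have [Qt tn ft] := topP f fb; have tj := tle f j fb.
  have Q3 : 3 <= Q by rewrite leq_addl.
  have /multsP[_ fw] : f \in mults k n by move: fb; rewrite inE => /andP[].
  have := @wsum_update n (expn^~ k) (coef f) (phi (f, j)) [:: 1; 2; top f].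
  rewrite /= !inE !big_cons !big_nil fw.
  have -> : (2 == top f) = false by lia.
  have -> : (1 == top f) = false by lia.
  have -> : 1 <= n by lia.
  have -> : 2 <= n by lia.
  rewrite tn => /(_ isT isT) H; have {H} := H _.
  rewrite /phi /= eqxx.
  have -> : (top f == 1) = false by lia.
  have -> : (top f == 2) = false by lia.
  move=> H; have {H} := H _; move=> /(_ _)/wrap[].
    by move=> x; rewrite !inE => /norP[/negPf -> /norP[/negPf -> /negPf ->]].
  rewrite exp1n -/K; move: tj ft; case: (coef f (top f)) => // c /= tj _.
  move: (top f ^ k) tj => T; move: (t (f, j)) => u; move: (wsum _ _ _) => W.
  rewrite mulSn; nia.
- by move=> a _ f fX _.
move=> [f j] [f' j'] /inX /= fb /inX /= fb' E.
have [Qt tn ft] := topP f fb; have [Qt' tn' ft'] := topP f' fb'.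
have tj := tle f j fb; have tj' := tle f' j' fb'.
have Q3 : 3 <= Q by rewrite leq_addl.
have n1 : 1 <= n by lia.
have n2 : 2 <= n by lia.
have dm q q' r r' : r < K -> r' < K -> r + K * q = r' + K * q' -> r = r' /\ q = q'.
  move=> rK rK' e; have rr : r = r'.
    by have := congr1 (modn^~ K) e; rewrite ![K * _]mulnC ![_ + _ * K]addnC !modnMDl !modn_small.
  by split=> //; move/eqP: e; rewrite rr eqn_add2l eqn_pmul2l // => /eqP.
(* Balancedness puts the old numbers of twos and ones below K, so they are digits that can be read
   off. *)
have [c2 e2] := dm _ _ _ _ (small f 2 fb n2) (small f' 2 fb' n2) (E 2).
move: e2; rewrite /= addnC [RHS]addnC => /(dm _ _ _ _ (small f 1 fb n1) (small f' 1 fb' n1))[c1 /val_inj jj].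
have tt : t (f, j) = t (f', j') by rewrite /t /= c1 jj.
have := E 1; rewrite /phi /= -tt -c1 => e1.
have {e1} e1 : top f ^ k = top f' ^ k.
  move: e1 tj tj'; rewrite /= -tt; move: (K * _) (_ ^ k) (_ ^ k) => u T T'.
  lia.
have {e1} topE : top f = top f' by apply/eqP; rewrite -(eqn_exp2r _ _ k0) e1.
congr (_, _) => //.
rewrite -(mk_multK (fun x => erefl (coef f x))) -(mk_multK (fun x => erefl (coef f' x))).
apply/ffunP => i; rewrite !ffunE; congr inord; move: (val i) => x.
have := E x; rewrite /phi /= -topE.
case: eqP => [->|_] //; case: eqP => [->|_] //; case: eqP => [->|_] //.
by rewrite -topE in ft'; lia.
Qed.

(** * From sorted sequences to multiplicity functions *)

(** The predicate [P] on the number of parts lets one bijection serve both [p] and [p_mod]. *)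
Lemma card_power_partitions (k n : nat) (P : pred nat) : 0 < k ->
  #|[set s in power_partitions k n | P (size (parts s))]| =
  #|[set f in mults k n | P (wsum n (fun=> 1) (coef f))]|.
Proof.
move=> k0.
have root (t : seq nat) : all (ltn 0) t -> all (is_power k) t -> 
    exists2 r, t = [seq m ^ k | m <- r] & all (ltn 0) r.
  elim: t => [|x t IH] /=; first by exists [::].
  move=> /andP[x0 /IH{}IH] /andP[/is_powerP-/(_ k0)[m xm] /IH[r -> r0]].
  by exists (m :: r); rewrite ?xm //= r0 andbT; move: x0; rewrite xm expn_gt0; lia.
have pow_inj : injective (expn^~ k) by move=> x y /eqP; rewrite eqn_exp2r // => /eqP.
pose F (s : n.-bseq 'I_n.+1) :=
  mk_mult n (fun m => if m == 0 then 0 else count_mem (m ^ k) (parts s)).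
have FE s : s \in power_partitions k n ->
    exists r, [/\ parts s = [seq m ^ k | m <- r], all (ltn 0) r, all (geq n) r,
      F s \in mults k n & coef (F s) =1 (fun m => count_mem m r)].
  rewrite inE => /andP[/and3P[_ s0 /eqP sn] sk].
  have [r sr r0] := root _ s0 sk; exists r.
  have sum_r : \sum_(m <- r) m ^ k = n by rewrite -sn sr sumnE big_map.
  have rn : all (geq n) r.
    apply/allP => m mr /=; rewrite -sum_r (big_rem m) //=.
    apply: leq_trans (leq_addr _ _); case: (m) => // m'.
    by rewrite -{1}[m'.+1]expn1 leq_pexp2l.
  have gE m : (if m == 0 then 0 else count_mem (m ^ k) (parts s)) = count_mem m r.
    case: eqP => [->|_].
      by apply/esym/count_memPn; apply/negP => /(allP r0).
    by rewrite sr count_map; apply: eq_count => x /=; rewrite (inj_eq pow_inj).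
  have [|m nm||FX FE] := @mults_coef_mk k n (fun m => if m == 0 then 0 else count_mem (m ^ k) (parts s)).
  - by [].
  - by rewrite gE; apply/count_memPn; apply: contraL nm => /(allP rn) /=; lia.
  - by rewrite (eq_wsum _ _ gE) wsum_count.
  split=> // m; rewrite -gE; exact: FE.
have size_F s : s \in power_partitions k n ->
    wsum n (fun=> 1) (coef (F s)) = size (parts s).
  move=> /FE[r [-> _ rn _ cr]].
  by rewrite (eq_wsum _ _ cr) wsum_count // big_const_seq count_predT iter_addn_0 mul1n size_map.
rewrite -(@card_in_imset _ _ F) => [|s s'].
  congr #|pred_of_set _|; apply/setP => f; apply/imsetP/idP => [[s]|].
    rewrite inE => /andP[sX Ps] ->; have [_ [_ _ _ FX _]] := FE s sX.
    by rewrite inE FX size_F.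
  rewrite inE => /andP[fX Pf]; have /multsP[f0 fw] := fX.
  (* For surjectivity, the bases are listed with multiplicity; their sorted k-th powers form the
     preimage. *)
  pose r := flatten [seq nseq (coef f m) m | m <- iota 1 n].
  have cr m : count_mem m r = coef f m.
    rewrite /r count_flatten -map_comp sumnE big_map.
    under eq_bigr => i _ do rewrite /= count_nseq /=.
    case: (boolP (m \in iota 1 n)) => mn.
      rewrite (bigD1_seq m) ?iota_uniq //= eqxx mul1n big1 ?addn0 // => i.
      by move=> /negPf ->.
    rewrite big1_seq => [|i /andP[_ /= ni]]; last first.
      by case: eqP => // im; rewrite im (negPf mn) in ni.
    move: mn; rewrite mem_iota negb_and -leqNgt leqn0 -leqNgt add1n.
    by case/orP => [/eqP ->|nm]; rewrite ?f0 ?coef_default.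
  have r0 : all (ltn 0) r.
    by apply/allP => m; case: m => // /count_memPn; rewrite cr f0.
  have rn : all (geq n) r.
    apply/allP => m /=; apply: contraLR; rewrite -ltnNge => nm.
    by apply/count_memPn; rewrite cr coef_default.
  have sum_r : \sum_(m <- r) m ^ k = n.
    by rewrite -fw -(wsum_count _ rn); apply: eq_wsum.
  have sp : is_partition n (sort geq [seq m ^ k | m <- r]).
    rewrite /is_partition sort_sorted; last by move=> x y; exact: leq_total.
    rewrite all_sort all_map sumnE (perm_big _ (permEl (perm_sort _ _))) big_map sum_r eqxx andbT /=.
    by apply/allP => m /(allP r0) /=; rewrite expn_gt0 => ->.
  have [s sE] := is_partition_bseq sp.
  have sX : s \in power_partitions k n.
    rewrite inE sE sp all_sort all_map; apply/allP => m _ /=.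
    by apply/is_powerP => //; exists m.
  have fs : f = F s.
    apply/esym/mk_multK => m; rewrite -cr sE; case: eqP => [->|_].
      by rewrite cr f0.
    rewrite (permP (permEl (perm_sort _ _))) count_map; apply: eq_count => x /=.
    by rewrite (inj_eq pow_inj).
  by exists s => //; rewrite inE sX -size_F // -fs.
(* Injectivity: sorted sequences with equal multiplicities coincide. *)
move=> /setIdP[sX _] /setIdP[s'X _] FF; apply: parts_inj.
have [r [sr _ _ _ cr]] := FE s sX; have [r' [sr' _ _ _ cr']] := FE s' s'X.
apply: (@sorted_eq _ geq).
- by move=> x y z yx xz; exact: leq_trans xz yx.
- by move=> x y; rewrite andbC; exact: anti_leq.
- by move: sX; rewrite inE => /andP[/and3P[]].
- by move: s'X; rewrite inE => /andP[/and3P[]].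
by rewrite sr sr' perm_map //; apply/allP => m _ /=; rewrite -cr -cr' FF.
Qed.

Section Counts.
Variables (k n : nat) (k0 : 0 < k).

Lemma p_mod2E (b : bool) : p_mod k b 2 n = #|parity_mults k n (odd n (+) b)|.
Proof.
rewrite /p_mod (@card_power_partitions k n (fun i => i == b %[mod 2]) k0).
apply: eq_card => f; rewrite !(in_set (fun f => (f \in mults k n) && _)).
case: (boolP (f \in mults k n)) => //= fX.
rewrite !modn2 oddb (even_size_parity k0 fX).
by case: (odd n); case: (odd (even_size _ _)); case: b.
Qed.

Lemma card_mults : p k n = #|mults k n|.
Proof.
have := card_power_partitions n predT k0.
by rewrite !setIdE !setIT.
Qed.
End Counts.

(** * Asymptotic equivalence and the final comparison *)

Local Open Scope classical_set_scope.
Local Open Scope ring_scope.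

(** Taking [M] at least 1 / eps reduces asymptotic equivalence to inequalities with natural
    factors. *)
Lemma equiv_of_archi (R : realType) (u v : nat -> R) :
  (forall M : nat, \forall n \near \oo, M%:R * `|u n - v n| <= `|v n|) -> u ~_\oo v.
Proof.
move=> uv; apply/eqaddoP => eps eps0.
have [M Meps] : exists M : nat, eps^-1 <= M%:R.
  by exists (Num.bound eps^-1); apply: ltW; rewrite archi_boundP // invr_ge0 ltW.
apply: filterS (uv M) => n uvn.
rewrite -ler_pdivrMl //; apply: le_trans uvn.
by rewrite ler_wpM2r.
Qed.

Theorem theorem2 (R : realType) (k : nat) (hk : (2 <= k)%N) :
  [/\ (fun n : nat => (p_mod k 0 2 n)%:R : R) ~_\oo
        (fun n : nat => (p_mod k 1 2 n)%:R : R),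
      (fun n : nat => (p_mod k 1 2 n)%:R : R) ~_\oo
        (fun n : nat => (p k n)%:R / 2 : R),
      \forall n \near \oo, ~~ odd n -> (p_mod k 1 2 n < p_mod k 0 2 n)%N
    & \forall n \near \oo, odd n -> (p_mod k 0 2 n < p_mod k 1 2 n)%N].
Proof.
have k0 : (0 < k)%N := ltnW hk.
(* The two counts are [x n] and [x n + d n], the larger one belonging to the parity of [n]. *)
pose x n := #|parity_mults k n true|; pose d n := #|balanced_mults k n|.
have pE n : p k n = (2 * x n + d n)%N.
  by rewrite card_mults // card_mults_parity card_parity_mults // /x /d; lia.
have p0E n : p_mod k 0 2 n = (x n + ~~ odd n * d n)%N.
  rewrite (p_mod2E n k0 false) addbF; case: odd; rewrite /= ?addn0 //.
  by rewrite card_parity_mults // mul1n.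
have p1E n : p_mod k 1 2 n = (x n + odd n * d n)%N.
  rewrite (p_mod2E n k0 true) addbT; case: odd; rewrite /= ?addn0 //.
  by rewrite card_parity_mults // mul1n.
have [n1 d_gt0] := balanced_mults_gt0 hk.
have small M : \forall n \near \oo, (M * d n <= 2 * x n + d n)%N.
  have [n0 le] := leq_mul_card_balanced M k0; exists n0 => // n /= /le.
  by rewrite -pE card_mults.
split.
(* The factor 2 M + 1 turns the bound by 2 x + d into M d <= x. *)
- apply: equiv_of_archi => M; apply: filterS (small (2 * M).+1) => n le.
  rewrite [`|(p_mod k 1 2 n)%:R|]ger0_norm // p0E p1E.
  have -> : `|(x n + ~~ odd n * d n)%:R - (x n + odd n * d n)%:R| = (d n)%:R :> R.
    rewrite !natrD opprD addrACA subrr add0r.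
    by case: odd; rewrite mul0n mul1n ?subr0 ?sub0r ?normrN ger0_norm.
  by rewrite -natrM ler_nat; lia.
- apply: equiv_of_archi => M; apply: filterS (small M) => n le.
  rewrite [`|_ / 2|]ger0_norm ?divr_ge0 // p1E pE.
  have -> : `|(x n + odd n * d n)%:R - (2 * x n + d n)%:R / 2| = (d n)%:R / 2 :> R.
    rewrite !natrD !natrM; set X := (x n)%:R; set D := (d n)%:R.
    have D0 : 0 <= D :> R by rewrite /D.
    case: odd; rewrite /= ?mul1r ?mul0r; last by rewrite distrC ger0_norm; lra.
    by rewrite ger0_norm; lra.
  by rewrite mulrA ler_pM2r ?invr_gt0 // -natrM ler_nat.
- exists n1 => // n /= /d_gt0; rewrite p0E p1E -/(d n) => dn; case: odd => //=; lia.
- exists n1 => // n /= /d_gt0; rewrite p0E p1E -/(d n) => dn; case: odd => //=; lia.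
Qed.
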